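(* Let $N\geq 1$ and let $\mathcal{H}_{X_1},\dots,\mathcal{H}_{X_N}$ be finite-dimensional Hilbert spaces. Let $\rho=|V\rangle\langle V|$ be a pure state (unit vector $|V\rangle$) on $\mathcal{H}_{X_1}\otimes\cdots\otimes\mathcal{H}_{X_N}$ such that $H(X_1)_\rho\neq 0$ and $$I(X_1:X_i)_\rho=0\quad\text{for all } i=2,\dots,N.$$ Then $$\sum_{i=1}^N H(X_i)_\rho>1.$$
   Context: For a density operator $\sigma$ (positive semidefinite, trace one), its von Neumann entropy is $-\mathrm{Tr}[\sigma\log\sigma]=-\sum_i\lambda_i\log\lambda_i$ where $\lambda_i$ are the eigenvalues of $\sigma$ and $\log$ is the binary logarithm (with $0\log 0=0$). For a subset $\mathcal{X}$ of the systems $\{X_1,\dots,X_N\}$, $\rho_{\mathcal{X}}$ is the reduced state obtained by taking the partial trace of $\rho$ over the tensor factors not in $\mathcal{X}$, and $H(\mathcal{X})_\rho$ denotes the von Neumann entropy of $\rho_{\mathcal{X}}$ (e.g. $H(X_iX_j)_\rho$ is the entropy of $\rho_{X_iX_j}$). The quantum mutual information is $I(X_i:X_j)_\rho=H(X_i)_\rho+H(X_j)_\rho-H(X_iX_j)_\rho$. *)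

(* Defs.v *)
From mathcomp Require Import all_boot all_order all_algebra.
From mathcomp Require Import complex.
From mathcomp Require Import reals exp.
Set Implicit Arguments. Unset Strict Implicit. Unset Printing Implicit Defensive.
Import Order.TTheory GRing.Theory Num.Theory.
Local Open Scope ring_scope.
Local Open Scope complex_scope.

Section QInfo.
Variable R : realType.
Variable N : nat.
Variable d : 'I_N -> nat.   (* d i = dim H_{X_i} *)

(* computational basis of H_{X_1} (x) ... (x) H_{X_N}: tuples (x_1,...,x_N) *)
Definition config := {dffun forall i : 'I_N, 'I_(d i)}.

Definition xlog2 (x : R) : R := if x == 0 then 0 else x * (ln x / ln 2).

Definition mx_of_fun (T : finType) (f : T -> T -> R[i]) : 'M[R[i]]_#|T| :=
  \matrix_(a, b) f (enum_val a) (enum_val b).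

(* von Neumann entropy: - sum_k lambda_k log lambda_k over the eigenvalues
   (with multiplicity) of sigma, as given by the spectral decomposition
   sigma = M^-1 diag(lambda) M (sigma is Hermitian, so the lambda_k are real). *)
Definition vN_entropy n (sigma : 'M[R[i]]_n) : R :=
  - \sum_(k < n) xlog2 (complex.Re (spectral_diag sigma 0 k)).

(* reduced state rho_{X_i} of rho = |V><V| : partial trace over all X_k, k != i *)
Definition rho1 (V : config -> R[i]) (i : 'I_N) : 'M[R[i]]_#|'I_(d i)| :=
  mx_of_fun (fun a b : 'I_(d i) =>
    \sum_(x : config | x i == a) \sum_(y : config | y i == b)
      (if [forall k, (k != i) ==> (x k == y k)] then V x * (V y)^* else 0)).

(* reduced state rho_{X_i X_j} (i != j) : partial trace over all X_k, k \notin {i,j} *)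
Definition rho2 (V : config -> R[i]) (i j : 'I_N)
    : 'M[R[i]]_#|{: 'I_(d i) * 'I_(d j)}| :=
  mx_of_fun (fun a b : 'I_(d i) * 'I_(d j) =>
    \sum_(x : config | (x i == a.1) && (x j == a.2))
    \sum_(y : config | (y i == b.1) && (y j == b.2))
      (if [forall k, ((k != i) && (k != j)) ==> (x k == y k)]
       then V x * (V y)^* else 0)).

Definition H1 (V : config -> R[i]) (i : 'I_N) : R := vN_entropy (rho1 V i).
Definition H2 (V : config -> R[i]) (i j : 'I_N) : R := vN_entropy (rho2 V i j).

Definition mutinfo (V : config -> R[i]) (i j : 'I_N) : R :=
  H1 V i + H1 V j - H2 V i j.

End QInfo.

(* Main.v *)
Require Import Defs.
From mathcomp Require Import all_boot all_order all_algebra.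
From mathcomp Require Import complex.
From mathcomp Require Import reals exp.
From mathcomp Require Import ring lra.
Import Order.TTheory GRing.Theory Num.Theory.
Set Implicit Arguments. Unset Strict Implicit. Unset Printing Implicit Defensive.
Local Open Scope ring_scope.

(** By the equality case of Klein's inequality, [I(X_1 : X_i) = 0] forces the
    reduced state on [X_1 X_i] to be a product. Let [lam_i] be the largest
    eigenvalue of the reduced state on [X_i] and [t_i] an eigenvector for it. As
    [H(X_1) <> 0], the reduced state on [X_1] has two eigenvectors with positive
    eigenvalue, and some combination [e <> 0] of them makes
    [e (x) t_2 (x) ... (x) t_N] orthogonal to [V]. Contract [V] with [e]: by the
    product property the contraction, normalized, still has weight [1 - lam_i]
    off [t_i] for every [i >= 2], and it is orthogonal to the product of the
    [t_i], so the union bound gives [1 <= \sum_(i >= 2) (1 - lam_i)]. Finally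
    [ln x <= x - 1] gives [(1 - lam_i) / ln 2 <= H(X_i)], and [ln 2 < 1]. *)

(** * Logarithm inequalities and the equality case of Klein's inequality *)

Section RealInequalities.
Variable R : realType.
Implicit Types x y s t : R.

Lemma ln_le_sub1 x : 0 < x -> ln x <= x - 1.
Proof.
move=> x0; have := @le_ln1Dx R (x - 1).
by rewrite [1 + _]addrC subrK; apply; lra.
Qed.

(** With [y] the square root of [x], the weak bound gives [ln x = 2 ln y <= 2 (y - 1)], which falls
    short of [y ^ 2 - 1] by [(y - 1) ^ 2 > 0]. *)
Lemma ln_lt_sub1 x : 0 < x -> x != 1 -> ln x < x - 1.
Proof.
move=> x0; have : 0 < Num.sqrt x by rewrite sqrtr_gt0.
have : x = Num.sqrt x * Num.sqrt x by rewrite -expr2 sqr_sqrtr // ltW.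
move: (Num.sqrt x) => y -> y0 y1; rewrite lnM ?posrE //.
have {}y1 : y != 1 by apply: contraNneq y1 => ->; rewrite mulr1.
have : 0 < (y - 1) ^+ 2 by rewrite exprn_even_gt0 //= subr_eq0.
by have := ln_le_sub1 y0; nra.
Qed.

Lemma ln2_lt1 : ln 2 < 1 :> R.
Proof.
have : ln 2 < 2 - 1 :> R by apply: ln_lt_sub1; rewrite ?gt_eqF //; lra.
by lra.
Qed.

Lemma xlog2E x : xlog2 x = x * ln x / ln 2.
Proof. by rewrite /xlog2; case: eqP => [->|_]; rewrite ?mul0r // mulrA. Qed.

(** The Bregman divergence of [s ln s]: a relative entropy term with a linear correction that makes
    each term nonnegative by itself. *)
Definition klein_gap s t := s * ln s - s * ln t - s + t.

(** For [s > 0] the gap is [s * (q - 1 - ln q)] with [q = t / s], so both the sign and the equality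
    case come from [ln q <= q - 1]. *)
Lemma klein_gap_ge0 s t : 0 <= s -> 0 < t -> 0 <= klein_gap s t ?= iff (s == t).
Proof.
rewrite /klein_gap le_eqVlt => /predU1P[<- t0|s0 t0].
  rewrite !mul0r !subr0 add0r; split; first exact: ltW.
  by rewrite eq_sym.
have -> : s * ln s - s * ln t - s + t = s * (t / s - 1 - ln (t / s)).
  by rewrite ln_div ?posrE //; field; rewrite gt_eqF.
have sN0 : s != 0 by rewrite gt_eqF.
have q0 : 0 < t / s by rewrite divr_gt0.
split; first by rewrite mulr_ge0 ?(ltW s0) // subr_ge0 ln_le_sub1.
have [<-|neq] := eqVneq s t; first by rewrite divff // ln1 subrr subr0 mulr0 eqxx.
apply/negbTE; rewrite eq_sym mulf_neq0 // gt_eqF // subr_gt0 ln_lt_sub1 //.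
by apply: contraNneq neq => /(congr1 ( *%R^~ s)); rewrite mul1r mulfVK // => ->.
Qed.

(* Expanding the relative entropy over the doubly stochastic overlaps [c] of
   two eigenbases turns it into a sum of nonnegative terms. *)
Lemma klein_equality (I J : finType) (s : I -> R) (t : J -> R) (c : I -> J -> R) :
  (forall i, 0 <= s i) -> (forall j, 0 <= t j) -> (forall i j, 0 <= c i j) ->
  (forall i, \sum_j c i j = 1) -> (forall j, \sum_i c i j = 1) ->
  \sum_i s i = \sum_j t j ->
  (forall i j, t j = 0 -> s i * c i j = 0) ->
  \sum_i s i * ln (s i) = \sum_j (\sum_i s i * c i j) * ln (t j) ->
  forall i j, c i j != 0 -> s i = t j.
Proof.
move=> s0 t0 c0 c1 c1' st supp ent.
have gap i j : 0 <= c i j * klein_gap (s i) (t j) ?= iff ((c i j == 0) || (s i == t j)).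
  (* When [t j = 0], [klein_gap_ge0] does not apply; [supp] then gives [s i = 0] or [c i j = 0], and
     the term vanishes either way. *)
  have [tj0|tj] := eqVneq (t j) 0; last first.
    have [ge0 eq0] : 0 <= klein_gap (s i) (t j) ?= iff (s i == t j).
      by apply: klein_gap_ge0; rewrite // lt_def tj t0.
    split; first by rewrite mulr_ge0.
    by rewrite eq_sym mulf_eq0 -eq0 [0 == _]eq_sym.
  have := supp i j tj0 => /eqP; rewrite mulf_eq0 => /orP[]/eqP e0; rewrite e0.
    by rewrite /klein_gap tj0 !mul0r subrr oppr0 !addr0 mulr0 eqxx orbT; apply/leif_refl.
  by rewrite mul0r eqxx; apply/leif_refl.
have tot : \sum_i \sum_j c i j * klein_gap (s i) (t j) = 0.
  under eq_bigr => i _ do (under eq_bigr => j _ do rewrite /klein_gap mulrDr !mulrBr;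
    rewrite big_split !sumrB -!mulr_suml c1 !mul1r).
  (* The logarithmic parts cancel by [ent], the linear parts by the equality of the total masses. *)
  rewrite big_split /= !sumrB ent.
  have -> : \sum_i \sum_j c i j * (s i * ln (t j)) =
            \sum_j (\sum_i s i * c i j) * ln (t j).
    rewrite exchange_big; apply: eq_bigr => j _; rewrite mulr_suml.
    by apply: eq_bigr => i _; rewrite mulrA [c i j * _]mulrC.
  have -> : \sum_i \sum_j c i j * t j = \sum_j t j.
    by rewrite exchange_big; apply: eq_bigr => j _; rewrite -mulr_suml c1' mul1r.
  by rewrite subrr add0r st addNr.
move=> i j cij; apply/eqP.
have inner k : 0 <= \sum_l c k l * klein_gap (s k) (t l).
  by apply: sumr_ge0 => l _; case: (gap k l).
have e1 : \sum_l c i l * klein_gap (s i) (t l) = 0.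
  by apply: (psumr_eq0P _ tot) => // k _; apply: inner.
have e0 : c i j * klein_gap (s i) (t j) = 0.
  by apply: (psumr_eq0P _ e1) => // l _; apply: (gap i l).1.
by have := (gap i j).2; rewrite e0 eqxx (negbTE cij) /= => <-.
Qed.

End RealInequalities.

(** * Eigenbases of Hermitian kernels *)

Section Kernels.
Variable R : realType.
Local Notation C := R[i].
Local Notation "x %:C" := (real_complex R x) (format "x %:C").
Implicit Type z : C.

(** The squared modulus, taken in [R] so that it can enter the real inequalities; [sqnormE] leads
    back to the complex numbers. *)
Definition sqnorm z : R := complex.Re (z * z^*).

Lemma sqnormE z : (sqnorm z)%:C = z * z^*.
Proof.
have := mul_conjC_ge0 z; rewrite /sqnorm; case: (z * z^*) => a b /=.
by rewrite lecE /= => /andP[/eqP -> _].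
Qed.

Lemma sqnorm_ge0 z : 0 <= sqnorm z.
Proof. by rewrite -ler0c sqnormE mul_conjC_ge0. Qed.

Lemma sqnorm_eq0 z : (sqnorm z == 0) = (z == 0).
Proof. by rewrite -(inj_eq (@complexI R)) sqnormE mul_conjC_eq0. Qed.

Lemma rmorph_sumC (I : finType) (F : I -> R) : (\sum_i F i)%:C = \sum_i (F i)%:C.
Proof. exact: rmorph_sum. Qed.

Definition orthonormal_family (I T : finType) (u : I -> T -> C) :=
  forall k l, \sum_x u k x * (u l x)^* = (k == l)%:R.
(** The resolution of the identity; [u k] is the [k]-th vector and [u k x] its coordinate at [x]. *)
Definition complete_family (I T : finType) (u : I -> T -> C) :=
  forall x y, \sum_k u k x * (u k y)^* = (x == y)%:R.

Lemma eigenbasis_exists (T : finType) (f : T -> T -> C) :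
    (forall x y, f y x = (f x y)^*) ->
  exists (u : T -> T -> C) (s : T -> R),
  [/\ orthonormal_family u, complete_family u,
      forall x y, f x y = \sum_k (s k)%:C * (u k x * (u k y)^*) &
      vN_entropy (mx_of_fun f) = - \sum_k xlog2 (s k)].
Proof.
move=> hf; set M := mx_of_fun f.
have Mh : M \is hermsymmx.
  apply/is_hermitianmxP; rewrite expr0 scale1r; apply/matrixP=> a b.
  by rewrite !mxE hf.
have /orthomx_spectralP ME := hermitian_normalmx Mh.
have Uu := spectral_unitarymx M.
have Dr := hermitian_spectral_diag_real Mh.
rewrite invmx_unitary // in ME.
have UU := unitarymxP Uu.
have UU' := mulmx1C UU.
have sumT (F : 'I_#|T| -> C) : \sum_k F k = \sum_(x : T) F (enum_rank x).
  by rewrite (reindex enum_rank) //; apply: onW_bij; apply: enum_rank_bij.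
move: ME UU UU' Dr; rewrite /vN_entropy; set U := spectralmx M; set D := spectral_diag M.
move=> ME UU UU' Dr.
(* As [M = U^* D U], the eigenvectors are the conjugated rows of [U]; [enum_rank] carries the
   indices back to [T]. *)
exists (fun k x => (U (enum_rank k) (enum_rank x))^*).
exists (fun k => complex.Re (D 0 (enum_rank k))); split.
- move=> k l; rewrite -(sumT (fun x => (U _ x)^* * ((U _ x)^*)^*)).
  have /matrixP/(_ (enum_rank l) (enum_rank k)) := UU; rewrite !mxE.
  rewrite (inj_eq enum_rank_inj) eq_sym => <-; apply: eq_bigr => x _.
  by rewrite !mxE conjCK mulrC.
- move=> x y; rewrite -(sumT (fun k => (U k _)^* * ((U k _)^*)^*)).
  have /matrixP/(_ (enum_rank x) (enum_rank y)) := UU'; rewrite !mxE.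
  rewrite (inj_eq enum_rank_inj) => <-; apply: eq_bigr => k _.
  by rewrite !mxE conjCK.
- move=> x y; have /matrixP/(_ (enum_rank x) (enum_rank y)) := ME.
  rewrite !mxE !enum_rankK => ->; rewrite sumT; apply: eq_bigr => k _.
  rewrite mul_mx_diag !mxE conjCK.
  have -> : (complex.Re (D 0 (enum_rank k)))%:C = D 0 (enum_rank k).
    by apply: RRe_real; have /mxOverP := Dr; apply.
  by rewrite mulrCA mulrA.
- by congr (- _); rewrite (reindex enum_rank) //; apply: onW_bij; apply: enum_rank_bij.
Qed.

Lemma parseval (I T : finType) (v : I -> T -> C) (f : T -> C) :
  complete_family v ->
  \sum_k (\sum_p f p * (v k p)^*) * (\sum_p f p * (v k p)^*)^* = \sum_p f p * (f p)^*.
Proof.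
move=> vc; transitivity (\sum_k \sum_p \sum_q (f p * (v k p)^*) * (f q * (v k q)^*)^*).
  apply: eq_bigr => k _; rewrite rmorph_sum mulr_suml /=.
  by apply: eq_bigr => p _; rewrite mulr_sumr.
rewrite exchange_big; apply: eq_bigr => p _; rewrite exchange_big /=.
have vpq q : \sum_k f p * (v k p)^* * (f q * (v k q)^*)^* =
             f p * (f q)^* * (q == p)%:R.
  rewrite -vc mulr_sumr; apply: eq_bigr => k _.
  by rewrite rmorphM /= conjCK; ring.
rewrite (bigD1 p) //= vpq eqxx mulr1 big1 ?addr0 // => q qp.
by rewrite vpq (negbTE qp) mulr0.
Qed.

End Kernels.

(** * Quadratic forms, product bases and partial traces *)

Section Product.
Variable R : realType.
Local Notation C := R[i].
Local Notation "x %:C" := (real_complex R x) (format "x %:C").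

Definition qform (T : finType) (r : T -> T -> C) (w : T -> C) : C :=
  \sum_p \sum_q (w p)^* * r p q * w q.

Lemma qform_spectral (I T : finType) (r : T -> T -> C) (s : I -> R) (z : I -> T -> C) w :
  (forall p q, r p q = \sum_j (s j)%:C * (z j p * (z j q)^*)) ->
  qform r w = \sum_j (s j)%:C * (sqnorm (\sum_p w p * (z j p)^*))%:C.
Proof.
move=> rE.
transitivity (\sum_p \sum_q \sum_j
  (s j)%:C * ((w q * (z j q)^*) * (w p * (z j p)^*)^*)).
  apply: eq_bigr => p _; apply: eq_bigr => q _; rewrite rE mulr_sumr mulr_suml.
  by apply: eq_bigr => j _; rewrite rmorphM /= conjCK; ring.
under eq_bigr => p _ do rewrite exchange_big.
rewrite exchange_big; apply: eq_bigr => j _; rewrite sqnormE rmorph_sum mulr_sumr /=.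
rewrite mulr_sumr; apply: eq_bigr => p _; rewrite mulr_suml mulr_sumr.
by [].
Qed.

Lemma qform_eigen (I T : finType) (r : T -> T -> C) (s : I -> R) (z : I -> T -> C) j :
  orthonormal_family z ->
  (forall p q, r p q = \sum_j (s j)%:C * (z j p * (z j q)^*)) ->
  qform r (z j) = (s j)%:C.
Proof.
move=> zo rE; rewrite (qform_spectral _ rE) (bigD1 j) //= zo eqxx sqnormE conjC1 !mulr1.
rewrite big1 ?addr0 // => k kj.
by rewrite zo eq_sym (negbTE kj) sqnormE mul0r mulr0.
Qed.

Lemma trace_spectral (I T : finType) (r : T -> T -> C) (s : I -> R) (z : I -> T -> C) :
  orthonormal_family z ->
  (forall p q, r p q = \sum_j (s j)%:C * (z j p * (z j q)^*)) ->
  \sum_p r p p = (\sum_j s j)%:C.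
Proof.
move=> zo rE; rewrite rmorph_sumC; under eq_bigr => p _ do rewrite rE.
rewrite exchange_big; apply: eq_bigr => j _.
by rewrite -mulr_sumr zo eqxx mulr1.
Qed.

Lemma sum_pair (V : nmodType) (A B : finType) (F : A * B -> V) :
  \sum_p F p = \sum_x \sum_y F (x, y).
Proof. by rewrite pair_bigA; apply: eq_bigr => -[]. Qed.

Variables A B : finType.
Variable r : A * B -> A * B -> C.

(** The numeral names the factor that is traced out. *)
Definition ptrace2 x x' : C := \sum_y r (x, y) (x', y).
Definition ptrace1 y y' : C := \sum_x r (x, y) (x, y').

Definition tensor (u : A -> A -> C) (w : B -> B -> C) : A * B -> A * B -> C :=
  fun k p => u k.1 p.1 * w k.2 p.2.

(** The factors in [a] and in [b] are kept apart, so that a sum over either index meets only its own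
    completeness relation. *)
Lemma qform_tensor u w a b : qform r (tensor u w (a, b)) =
  \sum_x \sum_x' \sum_y \sum_y'
    (u a x)^* * u a x' * (r (x, y) (x', y') * (w b y' * (w b y)^*)).
Proof.
rewrite /qform sum_pair; apply: eq_bigr => x _; rewrite [RHS]exchange_big /=.
apply: eq_bigr => y _; rewrite sum_pair; apply: eq_bigr => x' _.
by apply: eq_bigr => y' _; rewrite /tensor /= rmorphM /=; ring.
Qed.

Lemma sum_delta (V : pzRingType) (I : finType) (F : I -> V) j :
  \sum_i F i * (i == j)%:R = F j.
Proof.
rewrite (bigD1 j) //= eqxx mulr1 big1 ?addr0 // => i /negbTE ->.
by rewrite mulr0.
Qed.

(** Summing over [b] inserts the identity of the second factor, which forces [y' = y] and so traces
    that factor out. *)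
Lemma qform_marginal1 u w a : complete_family w ->
  \sum_b qform r (tensor u w (a, b)) = qform ptrace2 (u a).
Proof.
move=> wc; under eq_bigr => b _ do rewrite qform_tensor.
rewrite exchange_big; apply: eq_bigr => x _.
rewrite exchange_big; apply: eq_bigr => x' _.
rewrite exchange_big mulr_sumr mulr_suml; apply: eq_bigr => y _.
rewrite exchange_big /= -[RHS](sum_delta (fun y' => (u a x)^* * r (x, y) (x', y') * u a x')).
apply: eq_bigr => y' _; rewrite -wc mulr_sumr; apply: eq_bigr => b _; ring.
Qed.

Lemma qform_marginal2 u w b : complete_family u ->
  \sum_a qform r (tensor u w (a, b)) = qform ptrace1 (w b).
Proof.
move=> uc; under eq_bigr => a _ do rewrite qform_tensor.
(* The exchanges reorder the sums as [y], [y'], [x], [x'], [a], with [a] innermost for the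
   completeness of [u]. *)
rewrite exchange_big /=; under eq_bigr => x _.
  rewrite exchange_big; under eq_bigr => x' _ do
    (rewrite exchange_big; under eq_bigr => y _ do rewrite exchange_big).
  rewrite exchange_big; under eq_bigr => y _ do rewrite exchange_big.
  over.
rewrite exchange_big; apply: eq_bigr => y _.
rewrite exchange_big; apply: eq_bigr => y' _.
rewrite mulr_sumr mulr_suml; apply: eq_bigr => x _ /=.
rewrite -[RHS](sum_delta (fun x' => (w b y)^* * r (x, y) (x', y') * w b y')).
apply: eq_bigr => x' _; rewrite -uc mulr_sumr; apply: eq_bigr => a _; ring.
Qed.

Lemma complete_tensor u w :
  complete_family u -> complete_family w -> complete_family (tensor u w).
Proof.
move=> uc wc [x y] [x' y']; rewrite sum_pair /tensor /= xpair_eqE -mulnb natrM.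
rewrite -uc -wc mulr_suml; apply: eq_bigr => a _; rewrite mulr_sumr.
by apply: eq_bigr => b _; rewrite rmorphM /=; ring.
Qed.

Lemma orthonormal_tensor u w :
  orthonormal_family u -> orthonormal_family w -> orthonormal_family (tensor u w).
Proof.
move=> uo wo [a b] [a' b']; rewrite sum_pair /tensor /= xpair_eqE -mulnb natrM.
rewrite -uo -wo mulr_suml; apply: eq_bigr => x _; rewrite mulr_sumr.
by apply: eq_bigr => y _; rewrite rmorphM /=; ring.
Qed.

End Product.

(** * Zero mutual information forces a product state *)

Section ZeroMutualInformation.
Variable R : realType.
Local Notation C := R[i].
Local Notation "x %:C" := (real_complex R x) (format "x %:C").

Lemma ptrace2_hermitian (A B : finType) (r : A * B -> A * B -> C) :
  (forall p q, r q p = (r p q)^*) ->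
  forall x x', ptrace2 r x' x = (ptrace2 r x x')^*.
Proof. by move=> h x x'; rewrite rmorph_sum; apply: eq_bigr => y _; rewrite h. Qed.

Lemma ptrace1_hermitian (A B : finType) (r : A * B -> A * B -> C) :
  (forall p q, r q p = (r p q)^*) ->
  forall y y', ptrace1 r y' y = (ptrace1 r y y')^*.
Proof. by move=> h x x'; rewrite rmorph_sum; apply: eq_bigr => y _; rewrite h. Qed.

Lemma sqnormJ (z : C) : sqnorm z^* = sqnorm z.
Proof. by apply: (@complexI R); rewrite !sqnormE conjCK mulrC. Qed.

Lemma sqnorm_dotC (T : finType) (f g : T -> C) :
  sqnorm (\sum_p f p * (g p)^*) = sqnorm (\sum_p g p * (f p)^*).
Proof.
rewrite -sqnormJ rmorph_sum /=; congr sqnorm; apply: eq_bigr => p _.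
by rewrite rmorphM /= conjCK mulrC.
Qed.

(** Parseval for a unit vector; applied in both directions, it makes the overlaps of two orthonormal
    bases doubly stochastic. *)
Lemma sum_overlap (I T : finType) (v : I -> T -> C) (f : T -> C) :
  complete_family v -> \sum_p f p * (f p)^* = 1 ->
  \sum_k sqnorm (\sum_p f p * (v k p)^*) = 1.
Proof.
move=> vc f1; apply: (@complexI R); rewrite rmorph_sumC.
by under eq_bigr => k _ do rewrite sqnormE; rewrite parseval.
Qed.

Lemma expand_family (I T : finType) (v : I -> T -> C) (f : T -> C) p :
  complete_family v -> f p = \sum_k (\sum_q f q * (v k q)^*) * v k p.
Proof.
move=> vc; under eq_bigr => k _ do rewrite mulr_suml.
rewrite exchange_big -[LHS](sum_delta f); apply: eq_bigr => q _ /=.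
rewrite eq_sym -vc mulr_sumr; apply: eq_bigr => k _; ring.
Qed.

(** The mutual information is the relative entropy of [r] to the product of its marginals. Klein's
    equality case, for the eigenbasis [z] of [r] and the product eigenbasis [v] of the marginals,
    equates the eigenvalues of any two overlapping vectors, so the two kernels coincide. *)
Theorem zero_mutinfo_product (A B : finType) (r : A * B -> A * B -> C) :
  (forall p q, r q p = (r p q)^*) -> (forall w, 0 <= qform r w) ->
  \sum_p r p p = 1 ->
  vN_entropy (mx_of_fun (ptrace2 r)) + vN_entropy (mx_of_fun (ptrace1 r))
    = vN_entropy (mx_of_fun r) ->
  forall p q, r p q = ptrace2 r p.1 q.1 * ptrace1 r p.2 q.2.
Proof.
move=> rh rpsd rtr.
have [u [al [uo uc rAE ->]]] := eigenbasis_exists (ptrace2_hermitian rh).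
have [w [be [wo wc rBE ->]]] := eigenbasis_exists (ptrace1_hermitian rh).
have [z [s [zo zc rE ->]]] := eigenbasis_exists rh.
set v := tensor u w.
have vc : complete_family v by apply: complete_tensor.
have vo : orthonormal_family v by apply: orthonormal_tensor.
pose c j k := sqnorm (\sum_p v k p * (z j p)^*).
(* The diagonal of [r] in the basis [v]: a joint distribution whose marginals will be [al] and
   [be]. *)
pose m k := \sum_j s j * c j k.
have mE k : (m k)%:C = qform r (v k).
  by rewrite (qform_spectral _ rE) rmorph_sumC; apply: eq_bigr => j _; rewrite rmorphM.
have s0 j : 0 <= s j by rewrite -ler0c -(qform_eigen j zo rE).
have c0 j k : 0 <= c j k by apply: sqnorm_ge0.
have m0 k : 0 <= m k by apply: sumr_ge0 => j _; apply: mulr_ge0.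
have alE a : \sum_b m (a, b) = al a.
  apply: (@complexI R); rewrite rmorph_sumC -(qform_eigen a uo rAE).
  by rewrite -(qform_marginal1 _ _ _ wc); apply: eq_bigr => b _; apply: mE.
have beE b : \sum_a m (a, b) = be b.
  apply: (@complexI R); rewrite rmorph_sumC -(qform_eigen b wo rBE).
  by rewrite -(qform_marginal2 _ _ _ uc); apply: eq_bigr => a _; apply: mE.
have al0 a : 0 <= al a by rewrite -alE sumr_ge0.
have be0 b : 0 <= be b by rewrite -beE sumr_ge0.
have c1 j : \sum_k c j k = 1.
  under eq_bigr => k _ do rewrite /c sqnorm_dotC.
  by apply: sum_overlap => //; rewrite zo eqxx.
have c1' k : \sum_j c j k = 1 by apply: sum_overlap => //; rewrite vo eqxx.
have s1 : \sum_j s j = 1.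
  by apply: (@complexI R); rewrite -(trace_spectral zo rE).
have m1 : \sum_k m k = 1.
  rewrite /m exchange_big -[RHS]s1; apply: eq_bigr => j _.
  by rewrite -mulr_sumr c1 mulr1.
have al1 : \sum_a al a = 1.
  by rewrite -[RHS]m1 sum_pair; apply: eq_bigr => a _; rewrite alE.
have be1 : \sum_b be b = 1.
  by rewrite -[RHS]m1 sum_pair exchange_big; apply: eq_bigr => b _; rewrite -beE.
pose t k := al k.1 * be k.2.
(* The support condition: a marginal that vanishes is a sum of nonnegative entries of [m], so they
   all vanish. *)
have mal a b : al a = 0 -> m (a, b) = 0.
  by rewrite -alE => /psumr_eq0P -> //.
have mbe a b : be b = 0 -> m (a, b) = 0.
  by rewrite -beE => /psumr_eq0P => /(_ (fun i _ => m0 (i, b))) ->.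
rewrite -!sumrN => ent.
have key j k : c j k != 0 -> s j = t k.
  apply: klein_equality => //.
  - by move=> [a b]; apply: mulr_ge0.
  - rewrite s1 sum_pair /= -[LHS]al1; apply: eq_bigr => a _.
    by rewrite /t /= -mulr_sumr be1 mulr1.
  - move=> i [a b] /eqP; rewrite mulf_eq0 /= => ab0.
    have : m (a, b) = 0 by case/orP: ab0 => /eqP; [apply: mal | apply: mbe].
    by move=> /psumr_eq0P -> // l _; apply: mulr_ge0.
  have l2 : ln 2 != 0 :> R by rewrite gt_eqF // ln_gt0 // ltr1n.
  have -> : \sum_i s i * ln (s i) =
            \sum_a al a * ln (al a) + \sum_b be b * ln (be b).
    have x2 (T : finType) (g : T -> R) :
        \sum_i g i * ln (g i) = - (\sum_i - xlog2 (g i)) * ln 2.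
      rewrite -sumrN mulr_suml; apply: eq_bigr => i _.
      by rewrite opprK xlog2E mulfVK.
    by rewrite !x2 -ent opprD mulrDl.
  rewrite [RHS]sum_pair.
  transitivity (\sum_a \sum_b (m (a, b) * ln (al a) + m (a, b) * ln (be b))).
    under [RHS]eq_bigr => a _ do rewrite big_split /= -mulr_suml alE.
    rewrite big_split /=; congr (_ + _); rewrite exchange_big /=.
    by apply: eq_bigr => b _; rewrite -mulr_suml beE.
  apply: eq_bigr => a _; apply: eq_bigr => b _; rewrite -/(m _) -mulrDr /t /=.
  (* The logarithm of [al a * be b] splits only for positive factors; otherwise the weight
     [m (a, b)] is zero. *)
  have [a0|an] := eqVneq (al a) 0; first by rewrite mal // !mul0r.
  have [b0|bn] := eqVneq (be b) 0; first by rewrite mbe // !mul0r.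
  by rewrite lnM // posrE lt_def ?an ?bn ?al0 ?be0.
move=> p q; rewrite rE rAE rBE.
(* Expand [z j] in the basis [v]: [s j] may be replaced by [t k], because the coefficient is zero
   whenever they differ. *)
transitivity (\sum_k \sum_j (t k)%:C * ((\sum_x z j x * (v k x)^*) * v k p * (z j q)^*)).
  rewrite exchange_big; apply: eq_bigr => j _.
  rewrite [X in _ * (X * _)](expand_family (z j) p vc) mulr_suml mulr_sumr.
  apply: eq_bigr => k _.
  have [ck0|/key ->//] := eqVneq (c j k) 0.
  have -> : \sum_x z j x * (v k x)^* = 0.
    by apply/eqP; rewrite -sqnorm_eq0 sqnorm_dotC -/(c j k) ck0.
  by rewrite !mul0r !mulr0.
(* With [s j] gone, the sum over [j] is the expansion of [v k] in the basis [z], conjugated. *)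
transitivity (\sum_k (t k)%:C * (v k p * (v k q)^*)).
  apply: eq_bigr => k _; rewrite -mulr_sumr; congr (_ * _).
  transitivity (v k p * \sum_j (\sum_x z j x * (v k x)^*) * (z j q)^*).
    by rewrite mulr_sumr; apply: eq_bigr => j _; ring.
  congr (_ * _); rewrite [in RHS](expand_family (v k) q zc) rmorph_sum /=.
  apply: eq_bigr => j _; rewrite rmorphM rmorph_sum /=; congr (_ * _).
  by apply: eq_bigr => x _; rewrite [RHS]rmorphM /= conjCK mulrC.
rewrite sum_pair mulr_suml; apply: eq_bigr => a _; rewrite mulr_sumr.
apply: eq_bigr => b _; rewrite /t /v /tensor /= !rmorphM /=; ring.
Qed.

End ZeroMutualInformation.

(** * Reduced states as sums over labelled configurations *)

Section Reduced.
Variable R : realType.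
Local Notation C := R[i].
Local Notation "x %:C" := (real_complex R x) (format "x %:C").
Variables (X : finType) (V : X -> C).

(* [l] reads off the retained systems and [e] is equality of the traced-out ones. *)
Definition reduced (T : finType) (e : rel X) (l : X -> T) (p q : T) : C :=
  \sum_(x | l x == p) \sum_(y | l y == q) (if e x y then V x * (V y)^* else 0).

Lemma reduced_hermitian (T : finType) (e : rel X) (l : X -> T) : symmetric e ->
  forall p q, reduced e l q p = (reduced e l p q)^*.
Proof.
move=> es p q; rewrite rmorph_sum /= /reduced exchange_big /=.
apply: eq_bigr => x _; rewrite rmorph_sum; apply: eq_bigr => y _ /=.
by rewrite es; case: ifP => _; rewrite ?conjC0 // rmorphM /= conjCK mulrC.
Qed.

Lemma sum_label (T : finType) (l : X -> T) (g : T -> C) (F : X -> C) :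
  \sum_p g p * (\sum_(x | l x == p) F x) = \sum_x g (l x) * F x.
Proof.
rewrite [RHS](partition_big l xpredT) //=; apply: eq_bigr => p _.
by rewrite mulr_sumr; apply: eq_bigr => x /eqP ->.
Qed.

Lemma qform_reduced (T : finType) (e : rel X) (l : X -> T) w :
  qform (reduced e l) w =
  \sum_x \sum_(y | e x y) (w (l x))^* * V x * ((w (l y))^* * V y)^*.
Proof.
transitivity (\sum_p (w p)^* * \sum_(x | l x == p)
    \sum_y w (l y) * (if e x y then V x * (V y)^* else 0)).
  apply: eq_bigr => p _; rewrite mulr_sumr.
  under eq_bigr => q _ do rewrite -mulrA /reduced mulr_suml.
  under [X in _ = X]eq_bigr => x _ do rewrite -sum_label mulr_sumr.
  rewrite [RHS]exchange_big /=; apply: eq_bigr => q _.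
  by rewrite mulr_sumr; apply: eq_bigr => x _; rewrite [w q * _]mulrC.
rewrite sum_label; apply: eq_bigr => x _; rewrite mulr_sumr [RHS]big_mkcond.
apply: eq_bigr => y _; case: ifP => _; last by rewrite !mulr0.
by rewrite rmorphM /= conjCK; ring.
Qed.

(** Grouped by classes of [e], the form is a sum of squared moduli, one for each class. *)
Lemma qform_reduced_ge0 (T : finType) (e : rel X) (l : X -> T) w :
  equivalence_rel e -> 0 <= qform (reduced e l) w.
Proof.
move=> eE; pose h x := [set y | e x y].
have hE x y : e x y = (h x == h y).
  apply/idP/eqP => [exy|hxy].
    by apply/setP => t; rewrite !inE; have [_ /(_ exy)] := eE x y t.
  have : y \in h x by rewrite hxy inE (eE y y y).1.
  by rewrite inE.
rewrite qform_reduced; set g := fun x => (w (l x))^* * V x.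
rewrite (partition_big h xpredT) //=; apply: sumr_ge0 => c _.
rewrite (_ : \sum_(_ | _) _ = (\sum_(x | h x == c) g x) * (\sum_(x | h x == c) g x)^*).
  exact: mul_conjC_ge0.
rewrite rmorph_sum mulr_suml; apply: eq_bigr => x /eqP hx; rewrite mulr_sumr.
by apply: eq_bigl => y; rewrite hE hx eq_sym.
Qed.

(** The hypothesis says that retained and traced-out systems together determine the configuration,
    so only the terms [y = x] survive on the diagonal. *)
Lemma reduced_trace (T : finType) (e : rel X) (l : X -> T) :
  (forall x y, (l x == l y) && e x y = (x == y)) ->
  \sum_p reduced e l p p = \sum_x V x * (V x)^*.
Proof.
move=> el; rewrite [RHS](partition_big l xpredT) //=; apply: eq_bigr => p _.
apply: eq_bigr => x /eqP lx; rewrite -big_mkcondr /= (big_pred1 x) // => y.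
by rewrite -lx eq_sym el eq_sym.
Qed.

(** Tracing out a retained system moves its equality from the label into the relation. *)
Lemma ptrace2_reduced (A B : finType) (e e' : rel X) (l : X -> A * B) (l' : X -> A) :
  (forall x, (l x).1 = l' x) ->
  (forall x y, e' x y = ((l x).2 == (l y).2) && e x y) ->
  forall a a', ptrace2 (reduced e l) a a' = reduced e' l' a a'.
Proof.
move=> l1 ee a a'; rewrite /reduced (partition_big (fun x => (l x).2) xpredT) //=.
apply: eq_bigr => b _; apply: eq_big => [x|x].
  by rewrite -l1 (surjective_pairing (l x)) xpair_eqE.
rewrite (surjective_pairing (l x)) xpair_eqE => /andP[_ /eqP lb].
rewrite [RHS](bigID (fun y => (l y).2 == b)) /= [X in _ = _ + X]big1 => [|y /andP[_ yb]].
  rewrite addr0; apply: eq_big => y.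
    by rewrite -l1 (surjective_pairing (l y)) xpair_eqE.
  by rewrite (surjective_pairing (l y)) xpair_eqE => /andP[_ /eqP yb]; rewrite ee lb yb eqxx.
by rewrite ee lb eq_sym (negbTE yb).
Qed.

Lemma ptrace1_reduced (A B : finType) (e e' : rel X) (l : X -> A * B) (l' : X -> B) :
  (forall x, (l x).2 = l' x) ->
  (forall x y, e' x y = ((l x).1 == (l y).1) && e x y) ->
  forall b b', ptrace1 (reduced e l) b b' = reduced e' l' b b'.
Proof.
move=> l1 ee b b'; rewrite /reduced (partition_big (fun x => (l x).1) xpredT) //=.
apply: eq_bigr => a _; apply: eq_big => [x|x].
  by rewrite -l1 (surjective_pairing (l x)) xpair_eqE andbC.
rewrite (surjective_pairing (l x)) xpair_eqE => /andP[/eqP la _].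
rewrite [RHS](bigID (fun y => (l y).1 == a)) /= [X in _ = _ + X]big1 => [|y /andP[_ ya]].
  rewrite addr0; apply: eq_big => y.
    by rewrite -l1 (surjective_pairing (l y)) xpair_eqE andbC.
  by rewrite (surjective_pairing (l y)) xpair_eqE => /andP[/eqP ya _]; rewrite ee la ya eqxx.
by rewrite ee la eq_sym (negbTE ya).
Qed.

End Reduced.

(** Distributivity over dependent choices, obtained by seeing them through [fprod] as choices in the
    tagged union of the [T i]. *)
Lemma sum_dffun_prod (K : comPzRingType) (I : finType) (T : I -> finType)
    (F : forall i, T i -> K) :
  \sum_(k : {dffun forall i, T i}) \prod_i F i (k i) = \prod_i \sum_p F i p.
Proof.
rewrite (reindex (@dffun_of_fprod I T)); last exact/onW_bij/dffun_of_fprod_bij.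
transitivity (\sum_(t : fprod T) \prod_(i in I) [ffun p => F i p] (t i)).
  by apply: eq_bigr => t _; apply: eq_bigr => i _; rewrite !ffunE.
rewrite big_fprod.
transitivity (\prod_i \sum_(z in tagged_with T i) untag 0 [ffun p => F i p] z).
  exact/esym/bigA_distr_big_dep.
apply: eq_bigr => i _; rewrite -(big_tag (fun i => [ffun p => F i p])).
by apply: eq_bigr => p _; rewrite ffunE.
Qed.

(** * Amplitudes of the state in a product basis *)

Section Configurations.
Variable R : realType.
Local Notation C := R[i].
Local Notation "x %:C" := (real_complex R x) (format "x %:C").
Variables (N : nat) (d : 'I_N -> nat) (V : config d -> C).
Implicit Types (x y k : config d) (i j : 'I_N).

Definition agree (S : pred 'I_N) : rel (config d) :=
  fun x y => [forall j, S j ==> (x j == y j)].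

Lemma agree_equivalence S : equivalence_rel (agree S).
Proof.
move=> x y z; split; first by apply/forallP => j; rewrite eqxx implybT.
move=> /forallP xy; apply: eq_forallb => j; have := xy j.
by case: (S j) => //= /eqP ->.
Qed.

Lemma agree_sym S : symmetric (agree S).
Proof. by move=> x y; apply: eq_forallb => j; rewrite eq_sym. Qed.

Lemma agreeC_eq i x y : (x i == y i) && agree (predC1 i) x y = (x == y).
Proof.
apply/idP/eqP => [/andP[/eqP xi /forallP xy]|->].
  apply/ffunP => j; have := xy j; rewrite /=.
  by have [->|_ /eqP] := eqVneq j i.
by rewrite eqxx; apply/forallP => j; rewrite eqxx implybT.
Qed.

Lemma agree_split (S S' : pred 'I_N) i x y :
  S' i -> (forall j, S j = (j != i) && S' j) ->
  agree S' x y = (x i == y i) && agree S x y.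
Proof.
move=> S'i SE; apply/forallP/andP => [xy|[xi /forallP xy] j].
  split; first by have := xy i; rewrite S'i.
  by apply/forallP => j; rewrite SE; have := xy j; case: (j != i).
by have := xy j; rewrite SE; have [->|_] := eqVneq j i; rewrite ?xi ?implybT //.
Qed.

Definition red1 i := reduced V (agree (predC1 i)) (fun x => x i).
Definition red2 i j := reduced V (agree (predC (pred2 i j))) (fun x => (x i, x j)).

Arguments red1 i p q : clear implicits.
Arguments red2 i j p q : clear implicits.

Lemma rho1E i : rho1 V i = mx_of_fun (red1 i).
Proof. by []. Qed.

Lemma rho2E i j : rho2 V i j = mx_of_fun (red2 i j).
Proof.
apply/matrixP => p q; rewrite !mxE /red2 /reduced.
apply: eq_big => [x|x _]; first by rewrite [enum_val p in RHS]surjective_pairing xpair_eqE.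
apply: eq_big => [y|y _]; first by rewrite [enum_val q in RHS]surjective_pairing xpair_eqE.
by congr (if _ then _ else _); apply: eq_forallb => l; rewrite /= negb_or.
Qed.

Variable u : forall j, 'I_(d j) -> 'I_(d j) -> C.

(** The inner product of [V] with the product of the vectors [u (k j)]. *)
Definition amplitude k := \sum_(x : config d) (\prod_j (u (k j) (x j))^*) * V x.

(** A weight in product form lets the sum over [k] factor site by site. *)
Lemma amplitude_weighted (w : forall j, 'I_(d j) -> C) :
  \sum_(k : config d) (\prod_j w j (k j)) * (amplitude k * (amplitude k)^*) =
  \sum_(x : config d) \sum_(y : config d) V x * (V y)^* *
    \prod_j \sum_p w j p * ((u p (x j))^* * u p (y j)).
Proof.
transitivity (\sum_(k : config d) \sum_(x : config d) \sum_(y : config d) (\prod_j w j (k j)) *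
  ((\prod_j (u (k j) (x j))^* * V x) * (\prod_j (u (k j) (y j)) * (V y)^*))).
  apply: eq_bigr => k _; rewrite /amplitude rmorph_sum mulr_suml mulr_sumr.
  apply: eq_bigr => x _; rewrite !mulr_sumr; apply: eq_bigr => y _.
  rewrite rmorphM rmorph_prod /=; congr (_ * (_ * (_ * _))).
  by apply: eq_bigr => j _; rewrite conjCK.
rewrite exchange_big; apply: eq_bigr => x _.
rewrite exchange_big; apply: eq_bigr => y _ /=.
rewrite -(sum_dffun_prod (fun j p => w j p * ((u p (x j))^* * u p (y j)))) mulr_sumr.
by apply: eq_bigr => k _; rewrite !big_split /=; ring.
Qed.

Lemma prod_delta (S : pred 'I_N) x y :
  \prod_(j | S j) (x j == y j)%:R = (agree S x y)%:R :> C.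
Proof.
apply/esym; have [/forallP xy|/forallPn[j]] := boolP (agree S x y).
  by rewrite big1 // => j Sj; have := xy j; rewrite Sj /= => ->.
by rewrite negb_imply => /andP[Sj xy]; rewrite (bigD1 j) //= (negbTE xy) mul0r.
Qed.

(** Summing a site over a complete family traces it out, so the slice is the form of the reduced
    state on [S] at the vectors chosen by [t]. Completeness is asked only off [S] because the family
    at [X_1] will be a single repeated vector. *)
Lemma amplitude_slice (S : pred 'I_N) (t : config d) :
  (forall j, ~~ S j -> complete_family (@u j)) ->
  \sum_(k : config d | agree S k t) amplitude k * (amplitude k)^* =
  \sum_(x : config d) \sum_(y : config d | agree (predC S) x y)
    (\prod_(j | S j) u (t j) (x j))^* * V x * ((\prod_(j | S j) u (t j) (y j))^* * V y)^*.
Proof.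
(* The indicator of the slice, as a product of weights. *)
move=> uc; pose w j (p : 'I_(d j)) : C := if S j then (p == t j)%:R else 1.
transitivity (\sum_(k : config d) (\prod_j w j (k j)) * (amplitude k * (amplitude k)^*)).
  rewrite big_mkcond; apply: eq_bigr => k _; rewrite /w.
  rewrite -(big_mkcond S (fun j => (k j == t j)%:R)) prod_delta.
  by case: agree; rewrite ?mul1r ?mul0r.
rewrite amplitude_weighted; apply: eq_bigr => x _; rewrite [RHS]big_mkcond.
apply: eq_bigr => y _; rewrite (bigID S) /=.
rewrite [X in _ * (_ * X)](eq_bigr (fun j => (x j == y j)%:R)) => [|j Sj]; last first.
  rewrite eq_sym -uc //; apply: eq_bigr => p _.
  by rewrite /w (negbTE Sj) mul1r mulrC.
rewrite prod_delta -[X in if X then _ else _]/(agree (fun j => ~~ S j) x y).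
case: agree; last by rewrite !mulr0.
rewrite mulr1 rmorphM /= conjCK rmorph_prod /=.
rewrite (_ : \prod_(_ | _) _ =
  \prod_(j | S j) (u (t j) (x j))^* * \prod_(j | S j) u (t j) (y j)).
  by ring.
rewrite -big_split; apply: eq_bigr => j Sj; rewrite /w Sj.
rewrite (bigD1 (t j)) //= eqxx mul1r big1 ?addr0 // => p /negbTE ->.
by rewrite mul0r.
Qed.

End Configurations.

Arguments red1 {R N d} V i p q.
Arguments red2 {R N d} V i j p q.

(** * Reduced states and spectra of the pure state *)

Section PureState.
Variable R : realType.
Local Notation C := R[i].
Local Notation "x %:C" := (real_complex R x) (format "x %:C").
Variables (N : nat) (d : 'I_N -> nat) (V : config d -> C).
Hypothesis V1 : \sum_(x : config d) V x * (V x)^* = 1.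
Implicit Types (i j : 'I_N).

Lemma red1_trace i : \sum_p red1 V i p p = 1.
Proof.
rewrite -[RHS]V1; apply: reduced_trace => x y; exact: agreeC_eq.
Qed.

Lemma red2_ptrace2 i j : i != j -> ptrace2 (red2 V i j) =2 red1 V i.
Proof.
move=> ij; apply: ptrace2_reduced => // x y /=; apply: agree_split => [|l] /=.
  by rewrite eq_sym.
by rewrite negb_or andbC.
Qed.

Lemma red2_ptrace1 i j : i != j -> ptrace1 (red2 V i j) =2 red1 V j.
Proof.
move=> ij; apply: ptrace1_reduced => // x y /=; apply: agree_split => //= l.
by rewrite negb_or.
Qed.

Lemma red2_trace i j : i != j -> \sum_p red2 V i j p p = 1.
Proof.
move=> ij; rewrite -(red1_trace i) sum_pair.
by apply: eq_bigr => p _; rewrite -(red2_ptrace2 ij).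
Qed.

Lemma eq_mx_of_fun (T : finType) (f g : T -> T -> C) :
  f =2 g -> mx_of_fun f = mx_of_fun g.
Proof. by move=> fg; apply/matrixP => p q; rewrite !mxE. Qed.

Lemma mutinfo0_product i j : i != j -> mutinfo V i j = 0 ->
  forall p q, red2 V i j p q = red1 V i p.1 q.1 * red1 V j p.2 q.2.
Proof.
move=> ij /eqP; rewrite subr_eq0 /H1 /H2 !rho1E rho2E => /eqP ent p q.
rewrite -(red2_ptrace2 ij) -(red2_ptrace1 ij).
apply: zero_mutinfo_product.
- by apply: reduced_hermitian; apply: agree_sym.
- by move=> w; apply: qform_reduced_ge0; apply: agree_equivalence.
- exact: red2_trace.
- by rewrite (eq_mx_of_fun (red2_ptrace2 ij)) (eq_mx_of_fun (red2_ptrace1 ij)).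
Qed.

(** Bundled data, so that one choice over all [j] yields every eigenbasis; their properties are in
    [spectrum_exists]. *)
Record spectrum (j : 'I_N) := Spectrum {
  basis : 'I_(d j) -> 'I_(d j) -> C;
  eigenval : 'I_(d j) -> R;
  top : 'I_(d j);
  second : 'I_(d j) }.

(** Each [- ln (s p)] is at least [1 - s p >= 1 - m]; average this with the weights [s p]. *)
Lemma entropy_ge_max (T : finType) (s : T -> R) (m : R) :
  (forall p, 0 <= s p) -> \sum_p s p = 1 -> (forall p, s p <= m) ->
  (1 - m) / ln 2 <= - \sum_p xlog2 (s p).
Proof.
move=> s0 s1 sm; have l2 : 0 < ln 2 :> R by rewrite ln_gt0 // ltr1n.
have -> : (1 - m) / ln 2 = \sum_p s p * (1 - m) / ln 2 by rewrite -!mulr_suml s1 mul1r.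
rewrite -sumrN; apply: ler_sum => p _.
rewrite xlog2E -mulNr ler_pM2r ?invr_gt0 // -mulrN.
have := s0 p; rewrite le_eqVlt => /predU1P[<-|sp]; first by rewrite !mul0r.
by rewrite ler_pM2l //; have := ln_le_sub1 sp; have := sm p; lra.
Qed.

Lemma spectrum_exists j : exists S : spectrum j,
  [/\ orthonormal_family (basis S), complete_family (basis S),
      forall p q, red1 V j p q = \sum_k (eigenval S k)%:C * (basis S k p * (basis S k q)^*) &
  [/\ forall p, 0 <= eigenval S p, 0 < eigenval S (top S) <= 1,
      (1 - eigenval S (top S)) / ln 2 <= H1 V j &
      H1 V j != 0 -> second S != top S /\ 0 < eigenval S (second S)]].
Proof.
have [|b [s [bo bc rE HE]]] := @eigenbasis_exists R _ (red1 V j).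
  by apply: reduced_hermitian; apply: agree_sym.
have s0 p : 0 <= s p.
  rewrite -ler0c -(qform_eigen p bo rE); apply: qform_reduced_ge0.
  exact: agree_equivalence.
have s1 : \sum_p s p = 1.
  by apply: (@complexI R); rewrite -(trace_spectral bo rE) red1_trace.
have [p0 _ p0s] : exists2 p, p \in 'I_(d j) & s p != 0.
  apply/exists_inP; apply: contraPT (s1) => /exists_inPn s00.
  rewrite big1 => [/eqP|p _]; first by rewrite eq_sym oner_eq0.
  by apply/eqP; have := s00 p isT; rewrite negbK.
have [t _ tmax] := Order.TotalTheory.arg_maxP s (erefl : xpredT p0).
have t0 : 0 < s t by rewrite (lt_le_trans _ (tmax p0 isT)) // lt_def p0s s0.
have t1 : s t <= 1 by rewrite -s1 (bigD1 t) //= lerDl sumr_ge0.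
have Hge : (1 - s t) / ln 2 <= H1 V j.
  by rewrite /H1 rho1E HE; apply: entropy_ge_max => // p; apply: tmax.
have [/existsP[q /andP[qt qs]]|/existsPn none] := boolP [exists q, (q != t) && (s q != 0)].
  exists (Spectrum b s t q); split=> //; split=> //=; first by rewrite t0.
  by rewrite lt_def qs s0.
(* The second index is a placeholder: with a single nonzero eigenvalue, equal to 1, the entropy is
   zero. *)
exists (Spectrum b s t t); split=> //; split=> //=; first by rewrite t0.
have z q : q != t -> s q = 0 by have := none q; rewrite negb_and !negbK => /orP[->|/eqP].
have st : s t = 1 by rewrite -s1 (bigD1 t) //= big1 ?addr0.
case/negP; rewrite /H1 rho1E HE (bigD1 t) //= big1 => [|q /z ->].
  by rewrite st xlog2E ln1 mulr0 mul0r addr0 oppr0.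
by rewrite xlog2E !mul0r.
Qed.

End PureState.

(** The conjugates match the antilinear dependence of an amplitude on its basis vectors. *)
Lemma orthogonal_pair (C : numClosedFieldType) (x y : C) :
  exists c c' : C, (c != 0) || (c' != 0) /\ c^* * x + c'^* * y = 0.
Proof.
have [->|x0] := eqVneq x 0; first by exists 1, 0; rewrite oner_eq0 conjC0 mulr0 mul0r addr0.
exists (- y)^*, x^*; rewrite !conjCK !conjC_eq0 x0 orbT; split => //.
by rewrite mulNr mulrC addNr.
Qed.

Lemma qform_product (R : realType) (A B : finType) (r : A * B -> A * B -> R[i])
    (f : A -> A -> R[i]) (g : B -> B -> R[i]) (u : A -> R[i]) (w : B -> R[i]) :
  (forall p q, r p q = f p.1 q.1 * g p.2 q.2) ->
  qform r (fun p => u p.1 * w p.2) = qform f u * qform g w.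
Proof.
move=> rE; rewrite /qform sum_pair mulr_suml; apply: eq_bigr => x _ /=.
rewrite mulr_sumr; apply: eq_bigr => y _; rewrite sum_pair mulr_suml.
apply: eq_bigr => x' _; rewrite mulr_sumr; apply: eq_bigr => y' _.
by rewrite rE rmorphM /=; ring.
Qed.

(** * The orthogonal contraction and the union bound *)

Section Main.
Variable R : realType.
Local Notation C := R[i].
Local Notation "x %:C" := (real_complex R x) (format "x %:C").
Variables (N : nat) (d : 'I_N -> nat) (V : config d -> C) (a : 'I_N).
Hypothesis V1 : \sum_(x : config d) V x * (V x)^* = 1.
Hypothesis Ha : H1 V a != 0.
Hypothesis Ia : forall i, i != a -> mutinfo V a i = 0.

(** A configuration of the slice other than [t] differs from [t] at some [i != a], so the right side
    counts it at least once; [t] itself has no weight. *)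
Lemma union_bound (G : config d -> R) (t : config d) :
  (forall k, 0 <= G k) -> G t = 0 ->
  \sum_(k | agree (pred1 a) k t) G k <=
  \sum_(i | i != a) (\sum_(k | agree (pred1 a) k t) G k
                     - \sum_(k | agree (pred2 a i) k t) G k).
Proof.
move=> G0 Gt.
have diff i : i != a ->
    \sum_(k | agree (pred1 a) k t) G k - \sum_(k | agree (pred2 a i) k t) G k =
    \sum_(k | agree (pred1 a) k t) (k i != t i)%:R * G k.
  move=> ia; rewrite (bigID (fun k : config d => k i == t i)) /=.
  rewrite (eq_bigl (fun k => agree (pred2 a i) k t)) => [|k]; last first.
    rewrite andbC; apply/esym/agree_split => [|j] /=; first by rewrite eqxx orbT.
    by have [->|] := eqVneq j i; rewrite ?(negbTE ia) ?orbF.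
  rewrite addrAC subrr add0r big_mkcondr; apply: eq_bigr => k _.
  by case: (k i == t i); rewrite ?mul0r ?mul1r.
rewrite (eq_bigr _ diff) exchange_big /=; apply: ler_sum => k ka.
have [->|kt] := eqVneq k t; first by rewrite Gt sumr_ge0 // => i _; rewrite mulr0.
have /existsP[i ki] : [exists i, k i != t i].
  apply: contraNT kt; rewrite negb_exists => /forallP kt.
  by apply/eqP/ffunP => i; apply/eqP; have := kt i; rewrite negbK.
have ia : i != a.
  by apply: contraNneq ki => ->; have /forallP/(_ a) := ka; rewrite /= eqxx.
rewrite (bigD1 i) //= ki mul1r lerDl sumr_ge0 // => l _.
by rewrite mulr_ge0 // ler0n.
Qed.

Theorem one_lt_sum_entropy : 1 < \sum_i H1 V i.
Proof.
have [S SP] := fin_all_exists (spectrum_exists V1).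
pose b j := basis (S j); pose tp j := top (S j); pose sd j := second (S j).
pose be j := eigenval (S j) (tp j).
(* The amplitude of [V] with eigenvector [q] at [a] and the top eigenvectors elsewhere; [c] and [c']
   then make the combination [e a] orthogonal to [V] in this sense. *)
pose psi q := \sum_(x : config d)
  (b a q (x a))^* * (\prod_(j | j != a) (b j (tp j) (x j))^* * V x).
have [c [c' [cc' cpsi]]] := orthogonal_pair (psi (tp a)) (psi (sd a)).
pose e j x := c * b j (tp j) x + c' * b j (sd j) x.
(* At [a] the family is constantly [e a], so a slice, which fixes [k a], counts this vector once. *)
pose u j p := if j == a then e j else b j p.
pose t : config d := [ffun j => tp j].
pose G := amplitude V u.
have Gt : G t = 0.
  rewrite -[RHS]cpsi /G /amplitude /psi !mulr_sumr -big_split /=.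
  apply: eq_bigr => x _; rewrite (bigD1 a) //= /u eqxx /e rmorphD !rmorphM /=.
  rewrite (eq_bigr (fun j => (b j (tp j) (x j))^*)) => [|j ja]; first ring.
  by rewrite (negbTE ja) ffunE.
have bc j : complete_family (b j) by case: (SP j).
have slice1 : \sum_(k | agree (pred1 a) k t) G k * (G k)^* = qform (red1 V a) (e a).
  rewrite amplitude_slice => [|j /= ja]; last by rewrite /u (negbTE ja); apply: bc.
  rewrite qform_reduced; apply: eq_bigr => x _; apply: eq_bigr => y _.
  by rewrite !big_pred1_eq /u eqxx.
(* The product property enters here: fixing [t_i] at site [i] multiplies the weight by [be i]. *)
have slice2 i : i != a ->
    \sum_(k | agree (pred2 a i) k t) G k * (G k)^* = qform (red1 V a) (e a) * (be i)%:C.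
  move=> ia; rewrite amplitude_slice => [|j /=]; last first.
    by rewrite negb_or => /andP[ja _]; rewrite /u (negbTE ja); apply: bc.
  have [bo _ rE _] := SP i; rewrite -(qform_eigen (tp i) bo rE).
  have ai : a != i by rewrite eq_sym.
  rewrite -(qform_product _ _ (mutinfo0_product V1 ai (Ia ia))) qform_reduced.
  apply: eq_bigr => x _; apply: eq_bigr => y _.
  have pE z : \prod_(j | pred2 a i j) u j (t j) (z j) = e a (z a) * b i (tp i) (z i).
    rewrite (bigD1 a) /= ?eqxx // (big_pred1 i) => [|j] /=.
      by rewrite /u eqxx (negbTE ia) ffunE.
    by have [->|] := eqVneq j a; rewrite ?andbF ?andbT // (negbTE ai).
  by rewrite !pE.
pose m : R := \sum_(k | agree (pred1 a) k t) sqnorm (G k).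
have mE : m%:C = qform (red1 V a) (e a).
  by rewrite -slice1 rmorph_sum; apply: eq_bigr => k _; rewrite -sqnormE.
(* The vector [e a] overlaps the top eigenvector if [c != 0] and otherwise the second one, both of
   positive eigenvalue. *)
have m0 : 0 < m.
  have [bo _ rE [s0 /andP[t0 _] _ /(_ Ha)[sdtp sd0]]] := SP a.
  have ov q : \sum_p e a p * (b a q p)^* = c * (tp a == q)%:R + c' * (sd a == q)%:R.
    rewrite -!bo !mulr_sumr -big_split; apply: eq_bigr => p _ /=.
    by rewrite /e /b; ring.
  have -> : m = \sum_q eigenval (S a) q * sqnorm (\sum_p e a p * (b a q p)^*).
    apply: (@complexI R); rewrite mE (qform_spectral _ rE) rmorph_sumC.
    by apply: eq_bigr => q _; rewrite rmorphM.
  have tm q : 0 <= eigenval (S a) q * sqnorm (\sum_p e a p * (b a q p)^*).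
    by rewrite mulr_ge0 // sqnorm_ge0.
  have sq z : z != 0 -> 0 < sqnorm z by move=> z0; rewrite lt_def sqnorm_eq0 z0 sqnorm_ge0.
  have [c0|c0] := eqVneq c 0.
    rewrite c0 eqxx /= in cc'.
    rewrite (bigD1 (sd a)) //= ltr_pwDl ?sumr_ge0 // mulr_gt0 // sq //.
    by rewrite ov c0 mul0r eqxx mulr1 add0r.
  rewrite (bigD1 (tp a)) //= ltr_pwDl ?sumr_ge0 // mulr_gt0 // sq //.
  by rewrite ov eqxx (negbTE sdtp) mulr1 mulr0 addr0.
have m2 i : i != a -> \sum_(k | agree (pred2 a i) k t) sqnorm (G k) = m * be i.
  move=> ia; apply: (@complexI R); rewrite rmorphM /= mE -(slice2 i ia) rmorph_sum.
  by apply: eq_bigr => k _; rewrite -sqnormE.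
have defect : 1 <= \sum_(i | i != a) (1 - be i).
  rewrite -(ler_pM2l m0) mulr1 mulr_sumr.
  have Gt0 : sqnorm (G t) = 0 by apply/eqP; rewrite sqnorm_eq0 Gt.
  apply: le_trans (union_bound (fun k => sqnorm_ge0 (G k)) Gt0) _.
  by apply: ler_sum => i ia; rewrite m2 // mulrBr mulr1.
have l2 : 0 < ln 2 :> R by rewrite ln_gt0 // ltr1n.
have Hge i : (1 - be i) / ln 2 <= H1 V i by case: (SP i) => _ _ _ [].
have Ha0 : 0 <= H1 V a.
  apply: le_trans (Hge a); rewrite divr_ge0 ?(ltW l2) // subr_ge0.
  by case: (SP a) => _ _ _ [_ /andP[]].
(* The term of [a] enters through its sign only; the strict inequality comes from [ln 2 < 1]. *)
rewrite (bigD1 a) //= ltr_wpDl //.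
apply: (@lt_le_trans _ _ ((\sum_(i | i != a) (1 - be i)) / ln 2)); last first.
  by rewrite mulr_suml; apply: ler_sum.
rewrite ltr_pdivlMr // mul1r; exact: lt_le_trans (ln2_lt1 R) defect.
Qed.

End Main.

Theorem theorem1 (R : realType) (N : nat) (hN : (0 < N)%N) (d : 'I_N -> nat)
  (V : config d -> R[i])
  (hV : \sum_(x : config d) V x * (V x)^* = 1)
  (hH1 : H1 V (Ordinal hN) != 0)
  (hI : forall i : 'I_N, i != Ordinal hN -> mutinfo V (Ordinal hN) i = 0) :
  1 < \sum_(i < N) H1 V i.
Proof. exact: (one_lt_sum_entropy hV hH1 hI). Qed.
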